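(* Let $G$ be a Lie group acting canonically on the Poisson manifold $(P,\{\cdot,\cdot\})$. If the Mercer kernel $K\in C_b^3(P\times P)$ is argumentwise invariant under $G$, then for every $\lambda>0$ the kernel estimator $\widehat h_{\lambda,N}$ is $G$-invariant. If, additionally, the group action has an associated momentum map $\mathbf{J}:P\to\mathfrak{g}^*$, then its fibers are preserved by the flow $F_t$ of the Hamiltonian vector field $X_{\widehat h_{\lambda,N}}$, that is, $\mathbf{J}\circ F_t=\mathbf{J}$.
   Context: $P$ carries a Riemannian metric $g$. The Hamiltonian vector field of $h$ is $X_h=B^\sharp(\mathbf{d}h)$, where $B$ is the Poisson tensor, $B(z)(\mathbf{d}F(z),\mathbf{d}G(z))=\{F,G\}(z)$, and $B(z)(\alpha,\beta)=\alpha\cdot B^\sharp(z)(\beta)$. The compatible structure is $J=B^\sharp\circ g^\flat:TP\to TP$, assumed to satisfy $g(z)(J(z)v,J(z)v)\le\gamma(z)g(z)(v,v)$ for all $z\in P$, $v\in T_zP$, with $\gamma$ a positive function bounded above by a constant $C^2$, $C>0$. A Mercer kernel is a symmetric positive semidefinite function $K:P\times P\to\mathbb{R}$, with RKHS $\mathcal{H}_K$. $C_b^s$ spaces: for a second-countable manifold $M$ with complete Riemannian metric $g=g_0$ and fixed complete Riemannian metrics $g_k$ (norm $\|\cdot\|_k$) on the iterated tangent bundles $T^kM=T(T^{k-1}M)$, and with $D^kf:T^kM\to\mathbb{R}$ the differential of $D^{k-1}f:T^{k-1}M\to\mathbb{R}$, $C_b^s(M)$ is the set of $f\in C^s(M)$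 with $\|f\|_{C_b^s}:=\|f\|_\infty+\sum_{k=1}^s\|D^kf\|_\infty<\infty$, where $\|D^kf\|_\infty=\sup_{y\in T^{k-1}M}\sup_{0\ne v\in T_y(T^{k-1}M)}|D^kf(y)\cdot v|/\|v\|_{k-1}$; $C_b^s(P\times P)$ is this space for the product manifold. Kernel estimator: given data $\mathbf{Z}^{(n)}\in P$ and $\mathbf{X}^{(n)}_{\sigma^2}\in T_{\mathbf{Z}^{(n)}}P$, $n=1,\dots,N$ (noisy observations $\mathbf{X}^{(n)}_{\sigma^2}=X_H(\mathbf{Z}^{(n)})+\boldsymbol\varepsilon^{(n)}$ of a Hamiltonian vector field), and $\lambda>0$, $\widehat h_{\lambda,N}$ is the unique minimizer over $h\in\mathcal{H}_K$ of $\frac1N\sum_{n=1}^N\|X_h(\mathbf{Z}^{(n)})-\mathbf{X}^{(n)}_{\sigma^2}\|_g^2+\lambda\|h\|^2_{\mathcal{H}_K}$. A function $h:P\to\mathbb{R}$ is $G$-invariant if $h(a\cdot x)=h(x)$ for all $a\in G$, $x\in P$. A kernel $K$ is argumentwise invariant if $K(a\cdot x,a'\cdot x')=K(x,x')$ for all $a,a'\in G$, $x,x'\in P$. An action is canonical if it preserves the Poisson bracket. With $\mathfrak{g}$ the Lie algebra of $G$ and $\xi_P$ the infinitesimal generator of $\xi\in\mathfrak{g}$, if $\xi_P=X_{\mathbf{J}^\xi}$ with $\mathbf{J}^\xi\in C^\infty(P)$ for every $\xi\in\mathfrak{g}$, a momentum map is a map $\mathbf{J}:P\to\mathfrak{g}^*$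 defined by $\langle\mathbf{J}(z),\xi\rangle=\mathbf{J}^\xi(z)$ for all $\xi\in\mathfrak{g}$, $z\in P$. *)

(* Defs.v *)
From HB Require Import structures.
From mathcomp Require Import all_boot all_order all_algebra.
From mathcomp Require Import all_classical all_reals all_analysis.

Set Implicit Arguments.
Unset Strict Implicit.
Unset Printing Implicit Defensive.

Import Order.TTheory GRing.Theory Num.Theory.
Import numFieldNormedType.Exports.

Local Open Scope classical_set_scope.
Local Open Scope ring_scope.

(* The library has no manifolds.  A manifold is represented here by a bare     *)
(* type together with an atlas, its topology being the one induced by the      *)
(* atlas.  All model spaces used below are finite dimensional: 'rV[R]_n, R     *)
(* and their finite products.                                                  *)

Section calculus.
Variable R : realType.

(* For a finite-dimensional V this is the usual C^k on the open set U: all     *)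
(* iterated directional derivatives of order < k are differentiable on U, and  *)
(* those of order k are continuous on U.                                       *)
Fixpoint Ck_on (V W : normedModType R) (k : nat) (U : set V) (f : V -> W)
    : Prop :=
  if k is k'.+1 then
    (forall x, U x -> differentiable f x) /\
    (forall v, Ck_on k' U (fun x => 'd f x v))
  else forall x, U x -> {for x, continuous f}.

(* h \o phi^-1, for phi injective on D; the junk value 0 off phi @` D *)
Definition pull (M : Type) (V W : normedModType R) (D : set M) (phi : M -> V)
    (h : M -> W) : V -> W :=
  fun x => xget 0 [set y | exists z, [/\ D z, phi z = x & h z = y]].

Definition prodN (V W : normedModType R) : normedModType R := (V * W)%type.

End calculus.

(* [at_ z] is a preferred chart around z.  As in the usual implementation of   *)
(* tangent bundles over trivialising charts, the tangent space at z is the     *)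
(* model space V, a vector being given by its components in the chart [at_ z]. *)
Record charted (R : realType) (V : normedModType R) (M : Type) := Charted {
  idx : Type;
  dom : idx -> set M;
  chart : idx -> M -> V;
  at_ : M -> idx
}.

Section manifolds.
Variable R : realType.
Implicit Types V W : normedModType R.

Definition chart_at V M (c : charted V M) (z : M) : M -> V := chart (at_ c z).

Definition cimg V M (c : charted V M) (i : idx c) (A : set M) : set V :=
  chart i @` (dom i `&` A).

Definition trans V M (c : charted V M) (i j : idx c) : V -> V :=
  pull (dom i) (chart i) (chart j).

Definition mopen V M (c : charted V M) (A : set M) : Prop :=
  forall i : idx c, open (cimg i A).

Record is_manifold V M (c : charted V M) : Prop := IsManifold {
  man_at : forall z, dom (at_ c z) z;
  man_inj : forall (i : idx c) x y,
    dom i x -> dom i y -> chart i x = chart i y -> x = y;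
  man_overlap : forall i j : idx c, open (cimg i (dom j));
  man_trans : forall (i j : idx c) k, Ck_on k (cimg i (dom j)) (trans i j);
  man_hausdorff : forall x y, x <> y -> exists A B,
    [/\ mopen c A, mopen c B, A x, B y & A `&` B = set0];
  man_second_countable : exists B : nat -> set M,
    (forall n, mopen c (B n)) /\
    (forall A z, mopen c A -> A z -> exists n, B n z /\ B n `<=` A)
}.

Definition line : charted R^o R :=
  @Charted R R^o R unit (fun _ => setT) (fun _ => id) (fun _ => tt).

Definition prodC V W M N (c : charted V M) (d : charted W N) :
    charted (prodN V W) (M * N)%type :=
  @Charted R (prodN V W) (M * N)%type (idx c * idx d)%type
    (fun ij => dom ij.1 `*` dom ij.2)
    (fun ij z => (chart ij.1 z.1, chart ij.2 z.2))
    (fun z => (at_ c z.1, at_ d z.2)).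

Definition Ck_fun V M (c : charted V M) (k : nat) (f : M -> R) : Prop :=
  forall i : idx c,
    Ck_on k (cimg i setT) (pull (dom i) (chart i) (f : M -> R^o)).

Definition smooth_fun V M (c : charted V M) (f : M -> R) : Prop :=
  forall k, Ck_fun c k f.

(* The openness condition is the continuity of f. *)
Definition Ck_map V W M N (c : charted V M) (d : charted W N) (k : nat)
    (f : M -> N) : Prop :=
  forall (i : idx c) (j : idx d),
    open (cimg i (f @^-1` dom j)) /\
    Ck_on k (cimg i (f @^-1` dom j)) (pull (dom i) (chart i) (chart j \o f)).

Definition smooth_map V W M N (c : charted V M) (d : charted W N)
    (f : M -> N) : Prop :=
  forall k, Ck_map c d k f.

Definition dfun V M (c : charted V M) (f : M -> R) (z : M) :
    {linear V -> R^o} :=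
  'd (pull (dom (at_ c z)) (chart_at c z) (f : M -> R^o)) (chart_at c z z).

Definition velocity V M (c : charted V M) (gam : R -> M) (t : R) : V :=
  'D_(1 : R^o) (chart_at c (gam t) \o gam : R^o -> V) t.

(* The first condition makes gam continuous at t. *)
Definition has_velocity V M (c : charted V M) (gam : R -> M) (t : R) (v : V)
    : Prop :=
  (\forall s \near t, dom (at_ c (gam t)) (gam s)) /\
  is_derive (t : R^o) (1 : R^o) (chart_at c (gam t) \o gam : R^o -> V) v.

(* The preferred component vector at z of the tangent vector whose component   *)
(* vector in the chart i is u.                                                 *)
Definition of_chart V M (c : charted V M) (i : idx c) (z : M) (u : V) : V :=
  'd (trans i (at_ c z)) (chart i z) u.

Definition tanC V M (c : charted V M) : charted (prodN V V) (M * V)%type :=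
  @Charted R (prodN V V) (M * V)%type (idx c)
    (fun i => [set zv | dom i zv.1])
    (fun i zv => (chart i zv.1,
                  'd (trans (at_ c zv.1) i) (chart_at c zv.1 zv.1) zv.2))
    (fun zv => at_ c zv.1).

Fixpoint tmodel V (k : nat) : normedModType R :=
  if k is k'.+1 then prodN (tmodel V k') (tmodel V k') else V.

Fixpoint tcarrier V (M : Type) (k : nat) : Type :=
  if k is k'.+1 then (tcarrier V M k' * tmodel V k')%type else M.

(* the iterated tangent bundle T^k M *)
Fixpoint tanCk V M (c : charted V M) (k : nat) :
    charted (tmodel V k) (tcarrier V M k) :=
  if k is k'.+1 then tanC (tanCk c k') else c.

Fixpoint Dk V M (c : charted V M) (f : M -> R) (k : nat) :
    tcarrier V M k -> R :=
  if k is k'.+1 then fun yv => dfun (tanCk c k') (Dk c f (k := k')) yv.1 yv.2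
  else f.

Record riemannian V M (c : charted V M) (g : M -> V -> V -> R) : Prop :=
    Riemannian {
  riem_linear : forall z a u v w, g z (a *: u + v) w = a * g z u w + g z v w;
  riem_sym : forall z u v, g z u v = g z v u;
  riem_pos : forall z v, v != 0 -> 0 < g z v v;
  riem_smooth : forall (i : idx c) u w k,
    Ck_on k (cimg i setT)
      (pull (dom i) (chart i)
        ((fun z => g z (of_chart i z u) (of_chart i z w)) : M -> R^o))
}.

Definition curve_length V M (c : charted V M) (g : M -> V -> V -> R)
    (gam : R -> M) : \bar R :=
  (\int[lebesgue_measure]_(t in `[0%R, 1%R]%classic)
     (Num.sqrt (g (gam t) (velocity c gam t) (velocity c gam t)))%:E)%E.

(* A piecewise C^1 path can be reparametrised, stopping at its corners and at  *)
(* its end points, into a C^1 curve R -> M of the same length on [0, 1]; so    *)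
(* this is the usual Riemannian distance (+oo between components).             *)
Definition rdist V M (c : charted V M) (g : M -> V -> V -> R) (x y : M)
    : \bar R :=
  ereal_inf [set curve_length c g gam | gam in
    [set gam : R -> M | [/\ Ck_map line c 1 gam, gam 0 = x & gam 1 = y]]].

Definition complete_riemannian V M (c : charted V M) (g : M -> V -> V -> R)
    : Prop :=
  riemannian c g /\
  forall u : nat -> M,
    (forall e : R, 0 < e -> exists n0, forall m n, (n0 <= m)%N -> (n0 <= n)%N ->
       (rdist c g (u m) (u n) < e%:E)%E) ->
    exists x, forall e : R, 0 < e -> exists n0, forall n, (n0 <= n)%N ->
       (rdist c g (u n) x < e%:E)%E.

(* Adding 0 to the sets below only matters when M is empty or V is trivial. *)
Definition sup_norm (M : Type) (f : M -> R) : \bar R :=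
  ereal_sup (0%E |` [set (`|f z|)%:E | z in setT]).

(* the supremum norm of D^(k+1) f with respect to the metric gk on T^k M *)
Definition Dk_norm V M (c : charted V M) (k : nat)
    (gk : tcarrier V M k -> tmodel V k -> tmodel V k -> R) (f : M -> R)
    : \bar R :=
  ereal_sup (0%E |` [set r | exists y v, v != 0 /\
    r = (`|Dk c f (k := k.+1) (y, v)| / Num.sqrt (gk y v v))%:E]).

Definition Cb_norm V M (c : charted V M)
    (gs : forall k, tcarrier V M k -> tmodel V k -> tmodel V k -> R)
    (s : nat) (f : M -> R) : \bar R :=
  (sup_norm f + \sum_(k < s) Dk_norm c (gs k) f)%E.

Definition Cb V M (c : charted V M)
    (gs : forall k, tcarrier V M k -> tmodel V k -> tmodel V k -> R)
    (s : nat) (f : M -> R) : Prop :=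
  Ck_fun c s f /\ (Cb_norm c gs s f < +oo)%E.

End manifolds.

Section poisson.
Variables (R : realType) (n : nat) (P : Type) (cP : charted 'rV[R]_n P).

(* cotangent spaces, like tangent spaces, are read in the preferred charts *)
Definition covector := 'Hom('rV[R]_n, R^o).

Definition dform (f : P -> R) (z : P) : covector := linfun (dfun cP f z).

Record poisson_bracket (br : (P -> R) -> (P -> R) -> P -> R) : Prop :=
    PoissonBracket {
  pb_smooth : forall F G, smooth_fun cP F -> smooth_fun cP G ->
    smooth_fun cP (br F G);
  pb_linear : forall a F G H, smooth_fun cP F -> smooth_fun cP G ->
    smooth_fun cP H -> forall z,
    br (fun x => a * F x + G x) H z = a * br F H z + br G H z;
  pb_skew : forall F G, smooth_fun cP F -> smooth_fun cP G -> forall z,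
    br F G z = - br G F z;
  pb_jacobi : forall F G H, smooth_fun cP F -> smooth_fun cP G ->
    smooth_fun cP H -> forall z,
    br F (br G H) z + br G (br H F) z + br H (br F G) z = 0;
  pb_leibniz : forall F G H, smooth_fun cP F -> smooth_fun cP G ->
    smooth_fun cP H -> forall z,
    br (fun x => F x * G x) H z = F z * br G H z + G z * br F H z
}.

Record poisson_tensor (br : (P -> R) -> (P -> R) -> P -> R)
    (B : P -> covector -> covector -> R) : Prop := PoissonTensor {
  pt_linear : forall z a al be de,
    B z (a *: al + be) de = a * B z al de + B z be de;
  pt_skew : forall z al be, B z al be = - B z be al;
  pt_bracket : forall F G, smooth_fun cP F -> smooth_fun cP G -> forall z,
    B z (dform F z) (dform G z) = br F G z
}.

Definition sharp_of (B : P -> covector -> covector -> R)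
    (Bs : P -> covector -> 'rV[R]_n) : Prop :=
  forall z (al be : covector), B z al be = al (Bs z be).

Definition ham (Bs : P -> covector -> 'rV[R]_n) (h : P -> R) (z : P)
    : 'rV[R]_n := Bs z (dform h z).

Definition gflat (g : P -> 'rV[R]_n -> 'rV[R]_n -> R) (z : P) (v : 'rV[R]_n)
    : covector := linfun (g z v : 'rV[R]_n -> R^o).

Definition compat_struct (Bs : P -> covector -> 'rV[R]_n)
    (g : P -> 'rV[R]_n -> 'rV[R]_n -> R) (z : P) (v : 'rV[R]_n)
    : 'rV[R]_n := Bs z (gflat g z v).

Definition compat_bounded (Bs : P -> covector -> 'rV[R]_n)
    (g : P -> 'rV[R]_n -> 'rV[R]_n -> R) : Prop :=
  exists (gam : P -> R) (C : R),
    [/\ 0 < C, forall z, 0 < gam z <= C ^+ 2 &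
        forall z v, g z (compat_struct Bs g z v) (compat_struct Bs g z v)
                    <= gam z * g z v v].

(* A family of integral curves t |-> F t z, each defined on an open interval   *)
(* D z containing 0.  X need not be locally Lipschitz, so integral curves may  *)
(* fail to be unique and no maximality is asked for.                           *)
Definition is_flow (X : P -> 'rV[R]_n) (D : P -> set R) (F : R -> P -> P)
    : Prop :=
  forall z, [/\ open (D z), is_interval (D z), D z 0, F 0 z = z &
    forall t, D z t -> has_velocity cP (fun s => F s z) t (X (F t z))].

End poisson.

Section kernels.
Variables (R : realType) (T : Type) (K : T * T -> R).

Definition mercer : Prop :=
  (forall x y, K (x, y) = K (y, x)) /\
  (forall (N : nat) (x : 'I_N -> T) (a : 'I_N -> R),
     0 <= \sum_(i < N) \sum_(j < N) a i * a j * K (x i, x j)).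

Definition rkhs_norm (ip : (T -> R) -> (T -> R) -> R) (f : T -> R) : R :=
  Num.sqrt (ip f f).

(* These properties determine the space H and the restriction of ip to H       *)
(* (Moore-Aronszajn).                                                          *)
Record is_rkhs (H : set (T -> R)) (ip : (T -> R) -> (T -> R) -> R) : Prop :=
    IsRkhs {
  rkhs_zero : H (fun _ => 0);
  rkhs_comb : forall a f g, H f -> H g -> H (fun x => a * f x + g x);
  rkhs_linear : forall a f g h, H f -> H g -> H h ->
    ip (fun x => a * f x + g x) h = a * ip f h + ip g h;
  rkhs_sym : forall f g, H f -> H g -> ip f g = ip g f;
  rkhs_ge0 : forall f, H f -> 0 <= ip f f;
  rkhs_def : forall f, H f -> ip f f = 0 -> f = (fun _ => 0);
  rkhs_complete : forall u : nat -> T -> R, (forall k, H (u k)) ->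
    (forall e : R, 0 < e -> exists n0, forall m n, (n0 <= m)%N -> (n0 <= n)%N ->
       rkhs_norm ip (fun x => u m x - u n x) < e) ->
    exists2 f, H f & forall e : R, 0 < e -> exists n0, forall n, (n0 <= n)%N ->
       rkhs_norm ip (fun x => u n x - f x) < e;
  rkhs_section : forall x, H (fun y => K (x, y));
  rkhs_reproducing : forall f x, H f -> ip f (fun y => K (x, y)) = f x
}.

End kernels.

Section estimator.
Variables (R : realType) (n : nat) (P : Type) (cP : charted 'rV[R]_n P).

Definition risk (g : P -> 'rV[R]_n -> 'rV[R]_n -> R)
    (Bs : P -> covector R n -> 'rV[R]_n) (ip : (P -> R) -> (P -> R) -> R)
    (N : nat) (Z : 'I_N -> P) (X : 'I_N -> 'rV[R]_n) (lambda : R)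
    (h : P -> R) : R :=
  N%:R^-1 * (\sum_(i < N) g (Z i) (ham cP Bs h (Z i) - X i)
                                  (ham cP Bs h (Z i) - X i))
  + lambda * rkhs_norm ip h ^+ 2.

Definition unique_minimizer (S : set (P -> R)) (J : (P -> R) -> R)
    (h0 : P -> R) : Prop :=
  S h0 /\ forall h, S h -> h <> h0 -> J h0 < J h.

Definition kernel_estimator (g : P -> 'rV[R]_n -> 'rV[R]_n -> R)
    (Bs : P -> covector R n -> 'rV[R]_n)
    (H : set (P -> R)) (ip : (P -> R) -> (P -> R) -> R)
    (N : nat) (Z : 'I_N -> P) (X : 'I_N -> 'rV[R]_n) (lambda : R)
    (h : P -> R) : Prop :=
  unique_minimizer H (risk g Bs ip Z X lambda) h.

End estimator.

Section symmetry.
Variables (R : realType) (m : nat) (G : groupType) (cG : charted 'rV[R]_m G).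

Definition lie_group : Prop :=
  [/\ is_manifold cG,
      smooth_map (prodC cG cG) cG (fun ab : G * G => (ab.1 * ab.2)%g) &
      smooth_map cG cG (fun a : G => (a^-1)%g)].

(* c is t |-> exp (t xi), the one-parameter subgroup with velocity xi at 0;    *)
(* xi lies in the Lie algebra of G, i.e. the tangent space at 1.               *)
Definition one_param_subgroup (xi : 'rV[R]_m) (c : R -> G) : Prop :=
  [/\ smooth_map (line R) cG c, (forall s t, c (s + t) = (c s * c t)%g) &
      has_velocity cG c 0 xi].

Variables (n : nat) (P : Type) (cP : charted 'rV[R]_n P) (act : G -> P -> P).

Record lie_action : Prop := LieAction {
  act1 : forall z, act 1%g z = z;
  actM : forall a b z, act (a * b)%g z = act a (act b z);
  act_smooth : smooth_map (prodC cG cP) cP (fun az : G * P => act az.1 az.2)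
}.

Definition canonical_action (br : (P -> R) -> (P -> R) -> P -> R) : Prop :=
  forall a F F', smooth_fun cP F -> smooth_fun cP F' -> forall z,
    br (F \o act a) (F' \o act a) z = br F F' (act a z).

Definition G_invariant (h : P -> R) : Prop := forall a z, h (act a z) = h z.

Definition argwise_invariant (K : P * P -> R) : Prop :=
  forall a a' x x', K (act a x, act a' x') = K (x, x').

(* Y z = d/dt exp (t xi) . z at t = 0; the one-parameter subgroup of xi exists *)
(* and is unique.                                                              *)
Definition is_inf_generator (xi : 'rV[R]_m) (Y : P -> 'rV[R]_n) : Prop :=
  exists2 c, one_param_subgroup xi c &
    forall z, has_velocity cP (fun t => act (c t) z) 0 (Y z).

(* The dual of the Lie algebra is 'Hom('rV[R]_m, R^o). *)
Definition momentum_map (Bs : P -> covector R n -> 'rV[R]_n)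
    (J : P -> 'Hom('rV[R]_m, R^o)) : Prop :=
  forall xi, smooth_fun cP (fun z => J z xi) /\
             is_inf_generator xi (ham cP Bs (fun z => J z xi)).

End symmetry.

(* Main.v *)
Require Import Defs.
From mathcomp Require Import all_boot all_order all_algebra.
From mathcomp Require Import all_classical all_reals all_analysis.

Set Implicit Arguments.
Unset Strict Implicit.
Unset Printing Implicit Defensive.

Import Order.TTheory GRing.Theory Num.Theory.
Import numFieldNormedType.Exports.

(* Every f in H_K is G-invariant, because f(x) = <f, K_x> and K_(a x) = K_x.   *)
(* For a momentum map J, the derivative of J^xi along an integral curve of X_h *)
(* is dJ^xi(X_h) = {J^xi, h} = - dh(xi_P), and dh(xi_P) is the derivative of h *)
(* along the G-orbit t |-> exp(t xi) x, on which h is constant.                *)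

(** Invariance is [rkhs_invariant]. Conservation is Noether's theorem: [dfun_ham_skew] trades the
    derivative of J^xi along X_h for minus that of [h] along xi_P, [dfun_generator_eq0] makes the
    latter vanish, and [is_derive0_eq] integrates along the flow line. *)

Lemma diff_not_differentiable (R : numFieldType) (V W : normedModType R)
    (f : V -> W) (x v : V) :
  ~ differentiable f x -> 'd f x v = 0%R.
Proof.
(* ['d f x] is chosen by [get], whose default value is the zero map. *)
move=> ndf; rewrite /diff getPN// => df dfP; apply: ndf.
by apply/diffP; exact: (@getI _ (fun df : {linear V -> W} => _) df dfP).
Qed.

Lemma is_derive_diff_comp (R : numFieldType) (V W : normedModType R)
    (u : R^o -> V) (f : V -> W) (t : R^o) (v : V) :
  differentiable f (u t) -> is_derive t (1%R : R^o) u v ->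
  is_derive t (1%R : R^o) (f \o u) ('d f (u t) v).
Proof.
move=> df [/derivable1_diffP du <-].
have dfu : differentiable (f \o u) t by exact: differentiable_comp.
by split; [exact: diff_derivable | rewrite !deriveE// diff_comp].
Qed.

(** Mean value theorem on the segment between [a] and [b], which stays inside the interval [I]. *)
Lemma is_derive0_eq (R : realType) (I : set R) (f : R -> R) (a b : R) :
  is_interval I -> (forall t, I t -> is_derive t 1%R f 0%R) ->
  I a -> I b -> f a = f b.
Proof.
move=> itvI dfI; wlog ab : a b / (a <= b)%R => [hw Ia Ib|Ia Ib].
  by case/orP: (le_total a b) => ?; [|symmetry]; exact: hw.
have df x : x \in `[a, b]%R -> is_derive x 1%R f 0%R.
  by rewrite in_itv/= => ?; apply: dfI; exact: itvI Ia Ib _ _.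
apply/eqP; rewrite eq_sym -subr_eq0; apply/eqP.
have cf : {within `[a, b], continuous f}%classic.
  by apply: derivable_within_continuous => x /df[].
have dfoo x : x \in `]a, b[%R -> is_derive x 1%R f ((fun=> 0%R) x).
  by rewrite in_itv/= => /andP[ax xb]; apply: df; rewrite in_itv/= !ltW.
by have [c _ ->] := MVT_segment ab dfoo cf; rewrite mul0r.
Qed.

Lemma pullE (R : realType) (M : Type) (V W : normedModType R) (D : set M)
    (phi : M -> V) (f : M -> W) (z : M) :
  (forall x y, D x -> D y -> phi x = phi y -> x = y) -> D z ->
  pull D phi f (phi z) = f z.
Proof.
move=> inj Dz; rewrite /pull; case: xgetP => [y _ [x [Dx /inj xz <-]]|].
  by rewrite xz.
by move/(_ (f z)); case; exists z.
Qed.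

Lemma Ck_fun_differentiable (R : realType) (V : normedModType R) (M : Type)
    (c : charted V M) (k : nat) (f : M -> R) (z : M) :
  is_manifold c -> Ck_fun c k.+1 f ->
  differentiable (pull (dom (at_ c z)) (chart_at c z) (f : M -> R^o))
    (chart_at c z z).
Proof.
move=> hc /(_ (at_ c z))[df _]; apply: df; exists z => //; split => //.
exact: man_at.
Qed.

(** Chain rule in the preferred chart at [gam t]; the curve stays in its domain only near [t], which
    suffices for a derivative. *)
Lemma is_derive_along (R : realType) (V : normedModType R) (M : Type)
    (c : charted V M) (gam : R -> M) (t : R) (v : V) (f : M -> R) :
  is_manifold c -> has_velocity c gam t v ->
  differentiable (pull (dom (at_ c (gam t))) (chart_at c (gam t))
    (f : M -> R^o)) (chart_at c (gam t) (gam t)) ->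
  is_derive (t : R^o) (1%R : R^o) (f \o gam : R^o -> R^o) (dfun c f (gam t) v).
Proof.
move=> hc [near_dom dgam] df; apply: near_eq_is_derive; last first.
  exact: is_derive_diff_comp df dgam.
near=> s; rewrite /= /chart_at pullE //; last by near: s.
by move=> x y; exact: man_inj.
Unshelve. all: end_near. Qed.

(* Where f is not differentiable, its differential is the junk value 0.        *)
Lemma dfun_eq0_along (R : realType) (V : normedModType R) (M : Type)
    (c : charted V M) (gam : R -> M) (t : R) (v : V) (f : M -> R) (a : R) :
  is_manifold c -> has_velocity c gam t v -> (forall s, f (gam s) = a) ->
  dfun c f (gam t) v = 0%R.
Proof.
move=> hc gamv fa.
have [df|] := pselect (differentiable (pull (dom (at_ c (gam t)))
  (chart_at c (gam t)) (f : M -> R^o)) (chart_at c (gam t) (gam t))); last first.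
  exact: diff_not_differentiable.
have [_ <-] := is_derive_along hc gamv df.
have -> : f \o gam = cst a by apply/funext => s; exact: fa.
exact: derive_cst.
Qed.

Lemma rkhs_invariant (R : realType) (m n : nat) (G : groupType) (P : Type)
    (cG : charted 'rV[R]_m G) (cP : charted 'rV[R]_n P) (act : G -> P -> P)
    (K : P * P -> R) (H : set (P -> R)) (ip : (P -> R) -> (P -> R) -> R)
    (f : P -> R) :
  lie_action cG cP act -> argwise_invariant act K -> is_rkhs K H ip -> H f ->
  G_invariant act f.
Proof.
move=> hact hK hH Hf a z.
rewrite -!(rkhs_reproducing hH _ Hf); congr (ip f _); apply/funext => y.
(* Invariance in the first argument alone: let the identity act on the second. *)
by rewrite -(hK a 1%g z y) (act1 hact).
Qed.

(** Skewness is taken from the pointwise tensor [B], not from the bracket, whose laws concern smooth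
    functions; so it applies to [h]. *)
Lemma dfun_ham_skew (R : realType) (n : nat) (P : Type)
    (cP : charted 'rV[R]_n P) (br : (P -> R) -> (P -> R) -> P -> R)
    (B : P -> covector R n -> covector R n -> R)
    (Bs : P -> covector R n -> 'rV[R]_n) (e f : P -> R) (z : P) :
  poisson_tensor cP br B -> sharp_of B Bs ->
  dfun cP e z (ham cP Bs f z) = (- dfun cP f z (ham cP Bs e z))%R.
Proof.
move=> hB hBs; have := pt_skew hB z (dform cP e z) (dform cP f z).
by rewrite !hBs /dform !lfunE.
Qed.

Lemma dfun_generator_eq0 (R : realType) (m n : nat) (G : groupType) (P : Type)
    (cG : charted 'rV[R]_m G) (cP : charted 'rV[R]_n P) (act : G -> P -> P)
    (xi : 'rV[R]_m) (Y : P -> 'rV[R]_n) (f : P -> R) (z : P) :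
  is_manifold cP -> lie_action cG cP act -> G_invariant act f ->
  is_inf_generator cG cP act xi Y -> dfun cP f z (Y z) = 0%R.
Proof.
move=> hP hact finv [c [_ cM _] cY].
(* [c 0] is idempotent, hence the identity, so the orbit curve passes through [z] at time 0. *)
have c0 : c 0%R = 1%g by apply: (@mulgI _ (c 0%R)); rewrite -cM addr0 mulg1.
have := @dfun_eq0_along _ _ _ _ _ _ _ f (f z) hP (cY z).
by rewrite c0 (act1 hact); apply => s; exact: finv.
Qed.

Theorem proposition3p16 (R : realType)
  (* the Poisson manifold P with its Riemannian metric *)
  (n : nat) (P : Type) (cP : charted 'rV[R]_n P) (hP : is_manifold cP)
  (br : (P -> R) -> (P -> R) -> P -> R) (hbr : poisson_bracket cP br)
  (B : P -> covector R n -> covector R n -> R) (hB : poisson_tensor cP br B)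
  (Bs : P -> covector R n -> 'rV[R]_n) (hBs : sharp_of B Bs)
  (g : P -> 'rV[R]_n -> 'rV[R]_n -> R) (hg : riemannian cP g)
  (hJ : compat_bounded Bs g)
  (* the canonical action *)
  (m : nat) (G : groupType) (cG : charted 'rV[R]_m G) (hG : lie_group cG)
  (act : G -> P -> P) (hact : lie_action cG cP act)
  (hcan : canonical_action cP act br)
  (* the kernel, its RKHS, and the metrics on the bundles T^k (P x P) *)
  (gs : forall k, tcarrier (prodN 'rV[R]_n 'rV[R]_n) (P * P)%type k ->
     tmodel (prodN 'rV[R]_n 'rV[R]_n) k ->
     tmodel (prodN 'rV[R]_n 'rV[R]_n) k -> R)
  (hgs : forall k, complete_riemannian (tanCk (prodC cP cP) k) (gs k))
  (K : P * P -> R) (hK : mercer K) (hKCb : Cb (prodC cP cP) gs 3 K)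
  (H : set (P -> R)) (ip : (P -> R) -> (P -> R) -> R) (hH : is_rkhs K H ip)
  (hKinv : argwise_invariant act K)
  (* the data *)
  (N : nat) (hN : (0 < N)%N) (Z : 'I_N -> P) (X : 'I_N -> 'rV[R]_n) :
  forall lambda : R, (0 < lambda)%R ->
  forall h : P -> R, kernel_estimator cP g Bs H ip Z X lambda h ->
    G_invariant act h /\
    (forall J : P -> 'Hom('rV[R]_m, R^o), momentum_map cG cP act Bs J ->
       forall (D : P -> set R) (F : R -> P -> P),
         is_flow cP (ham cP Bs h) D F ->
         forall (z : P) (t : R), D z t -> J (F t z) = J z).
Proof.
move=> lambda _ h [Hh _].
have hinv := rkhs_invariant hact hKinv hH Hh.
split=> // J hJmap D F hF z t Dt; apply/lfunP => xi.
have [Jsm Jgen] := hJmap xi; have [_ itvD D0 F0 FX] := hF z.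
(* The claim becomes constancy of J^xi along the integral curve over the interval [D z]. *)
rewrite -[in RHS]F0.
apply: (is_derive0_eq (f := fun s => J (F s z) xi) itvD _ Dt D0) => s Ds.
have dJ := Ck_fun_differentiable (F s z) hP (Jsm 1%N).
have := is_derive_along hP (FX s Ds) dJ.
rewrite (dfun_ham_skew _ _ _ hB hBs).
by rewrite (dfun_generator_eq0 _ hP hact hinv Jgen) oppr0.
Qed.
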